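(* Let $\Delta t > 0$, $c > 0$, $\gamma > 0$, $\beta \geq 0$ and $\mathfrak{m}^2 \geq 0$ be real numbers, and consider the linear finite-difference scheme $$\frac{\delta_t^2 u_n^k}{(\Delta t)^2} - \left( \frac{c^2}{4} \delta^2 + \frac{\beta}{2 \Delta t} \delta_t \right) \delta_x^2 u_n^k + \frac{\gamma}{2 \Delta t} \delta_t u_n^k + \frac{\mathfrak{m}^2}{2} \bar{\delta} u_n^k = 0 .$$ If $$\frac{2}{\gamma} < \Delta t < \frac{\sqrt{2}}{c},$$ then the scheme is linearly stable in the infinite norm, that is, its von Neumann amplification matrix $A(\xi)$ satisfies $\| A(\xi) \|_\infty \leq 1$ for all $\xi \in [0, \pi]$.
   Context: The difference operators are $$\delta_t u_n^k = u_n^{k+1} - u_n^{k-1}, \quad \delta_t^2 u_n^k = u_n^{k+1} - 2 u_n^k + u_n^{k-1}, \quad \delta_x^2 u_n^k = u_{n+1}^k - 2 u_n^k + u_{n-1}^k,$$ $$\bar{\delta} u_n^k = u_n^{k+1} + u_n^{k-1}, \quad \delta^2 u_n^k = u_n^{k+1} + 2 u_n^k + u_n^{k-1},$$ with operators in the time index $k$ and space index $n$ composed. Substituting a Fourier mode $u_n^k = \hat{u}^k e^{i n \xi}$ (where $k$ in $\hat u^k$ is a time index) in the scheme gives $\hat{g}(\xi) \hat{u}^{k+1} = \hat{f}(\xi) \hat{u}^k - \hat{h}(\xi) \hat{u}^{k-1}$, and the von Neumann amplification matrix is $$A(\xi) = \begin{pmatrix} \dfrac{\hat{f}(\xi)}{\hat{g}(\xi)}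 & - \dfrac{\hat{h}(\xi)}{\hat{g}(\xi)} \\ 1 & 0 \end{pmatrix},$$ where $$\hat{f}(\xi) = 2 - 2 c^2 (\Delta t)^2 \sin^2 \left( \tfrac{\xi}{2} \right),$$ $$\hat{g}(\xi) = 1 + \left[ c^2 (\Delta t)^2 + 2 \beta \Delta t \right] \sin^2 \left( \tfrac{\xi}{2} \right) + \frac{\mathfrak{m}^2 (\Delta t)^2 + \gamma \Delta t}{2},$$ $$\hat{h}(\xi) = 1 + \left[ c^2 (\Delta t)^2 - 2 \beta \Delta t \right] \sin^2 \left( \tfrac{\xi}{2} \right) + \frac{\mathfrak{m}^2 (\Delta t)^2 - \gamma \Delta t}{2}.$$ Here $\| \cdot \|_\infty$ is the matrix norm induced by the maximum norm, i.e. the maximum absolute row sum. *)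

(* Defs.v *)
From HB Require Import structures.
From mathcomp Require Import all_boot all_order all_algebra.
From mathcomp Require Import all_classical all_reals all_analysis.
From mathcomp Require Import complex.

Set Implicit Arguments.
Unset Strict Implicit.
Unset Printing Implicit Defensive.

Import Order.TTheory GRing.Theory Num.Theory.
Local Open Scope ring_scope.
Local Open Scope complex_scope.

(* [u n k] is the value at space index n and time index k. *)
Definition grid (V : Type) := int -> int -> V.

Section Operators.
Variable V : zmodType.
Implicit Type u : grid V.

Definition delta_t u : grid V := fun n k => u n (k + 1) - u n (k - 1).

Definition delta_tt u : grid V :=
  fun n k => u n (k + 1) - u n k *+ 2 + u n (k - 1).

Definition delta_xx u : grid V :=
  fun n k => u (n + 1) k - u n k *+ 2 + u (n - 1) k.

Definition delta_bar u : grid V := fun n k => u n (k + 1) + u n (k - 1).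

(* The averaging operator written $\delta^2$ (without subscript). *)
Definition delta_sq u : grid V :=
  fun n k => u n (k + 1) + u n k *+ 2 + u n (k - 1).

End Operators.

Section Scheme.
Variable R : realType.

(* Left-hand side of the scheme.  The parameters are real, and [msq] is the
   real number $\mathfrak{m}^2$; grid functions are complex-valued so that
   Fourier modes can be substituted. *)
Definition scheme (dt c gamma beta msq : R) (u : grid R[i]) : grid R[i] :=
  fun n k =>
    delta_tt u n k / (dt ^+ 2)%:C
    - ((c ^+ 2 / 4)%:C * delta_sq (delta_xx u) n k
       + (beta / (2 * dt))%:C * delta_t (delta_xx u) n k)
    + (gamma / (2 * dt))%:C * delta_t u n k
    + (msq / 2)%:C * delta_bar u n k.

(* $\hat u^k e^{i n \xi}$, the exponential being given by Euler's formula. *)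
Definition fourier_mode (xi : R) (uhat : int -> R[i]) : grid R[i] :=
  fun n k => uhat k * (cos (n%:~R * xi) +i* sin (n%:~R * xi)).

Definition state (uhat : int -> R[i]) (k : int) : 'cV[R[i]]_2 :=
  \col_(i < 2) (if i == 0 then uhat k else uhat (k - 1)).

(* A mode satisfies the scheme L u = 0 at time level k exactly when A maps the
   state (uhat^k, uhat^(k-1)) to (uhat^(k+1), uhat^k).  Since uhat is arbitrary,
   at most one A has this property as soon as the scheme determines uhat^(k+1)
   from arbitrary uhat^k and uhat^(k-1). *)
Definition is_amplification_matrix (L : grid R[i] -> grid R[i]) (xi : R)
    (A : 'M[R]_2) : Prop :=
  forall (uhat : int -> R[i]) (k : int),
    (forall n : int, L (fourier_mode xi uhat) n k = 0) <->
    state uhat (k + 1) = map_mx (real_complex R) A *m state uhat k.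

Definition fhat (dt c xi : R) : R :=
  2 - 2 * c ^+ 2 * dt ^+ 2 * sin (xi / 2) ^+ 2.

Definition ghat (dt c gamma beta msq xi : R) : R :=
  1 + (c ^+ 2 * dt ^+ 2 + 2 * beta * dt) * sin (xi / 2) ^+ 2
  + (msq * dt ^+ 2 + gamma * dt) / 2.

Definition hhat (dt c gamma beta msq xi : R) : R :=
  1 + (c ^+ 2 * dt ^+ 2 - 2 * beta * dt) * sin (xi / 2) ^+ 2
  + (msq * dt ^+ 2 - gamma * dt) / 2.

Definition amplification_matrix (dt c gamma beta msq xi : R) : 'M[R]_2 :=
  let f := fhat dt c xi in
  let g := ghat dt c gamma beta msq xi in
  let h := hhat dt c gamma beta msq xi in
  \matrix_(i < 2, j < 2)
    if i == 0 then (if j == 0 then f / g else - (h / g))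
    else (if j == 0 then 1 else 0).

(* The operator norm induced by the maximum norm, i.e. the maximum absolute
   row sum.  The library's norm `|A| on matrices is a different one: the
   largest absolute value of an entry. *)
Definition norm_inf (m n : nat) (A : 'M[R]_(m, n)) : R :=
  \big[Num.max/0]_(i < m) \sum_(j < n) `|A i j|.

Definition linearly_stable_inf (L : grid R[i] -> grid R[i])
    (A : R -> 'M[R]_2) : Prop :=
  forall xi : R, 0 <= xi <= pi ->
    is_amplification_matrix L xi (A xi) /\ norm_inf (A xi) <= 1.

End Scheme.

(* Main.v *)
Require Import Defs.
From mathcomp Require Import all_boot all_order all_algebra.
From mathcomp Require Import all_classical all_reals all_analysis.
From mathcomp Require Import complex ring lra.

(* On a Fourier mode, delta_x^2 acts as multiplication by -4 s^2 with
   s = sin (xi / 2), so dt^2 times the scheme is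
   (g uhat^(k+1) - f uhat^k + h uhat^(k-1)) e^(i n xi), which gives the
   amplification matrix as g > 0.  Its second row has absolute sum 1, and the
   first row reduces to |f| + |h| <= g, i.e. four inequalities:
   gamma dt > 2 yields f + h <= g, together with c^2 dt^2 < 2 it yields
   h - f <= g, and the other two, -f - h <= g and f - h <= g, need only m^2 >= 0. *)

Import Order.TTheory GRing.Theory Num.Theory.
Local Open Scope ring_scope.

Section FourierModes.
Local Open Scope complex_scope.
Variable R : realType.
Implicit Types (xi : R) (uhat : int -> R[i]) (n k : int).

Lemma cos_double_half xi : cos xi = 1 - 2 * sin (xi / 2) ^+ 2.
Proof.
have -> : cos xi = cos (xi / 2 + xi / 2) by congr cos; field.
by rewrite cosD -!expr2 cos2sin2; ring.
Qed.

(** Shifting n by 1 or -1 multiplies the mode by e^(i xi) or e^(-i xi); the sine parts cancel in the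
    sum, leaving the factor 2 cos xi - 2. *)
Lemma delta_xx_fourier_mode xi uhat n k :
  delta_xx (fourier_mode xi uhat) n k =
    (- 4 * sin (xi / 2) ^+ 2)%:C * fourier_mode xi uhat n k.
Proof.
rewrite /delta_xx /fourier_mode !rmorphD !rmorphN /= !mulrDl !mulNr mul1r.
case: (uhat k) => a b; apply/eqP; rewrite eq_complex /=.
rewrite cosD cosB sinD sinB (cos_double_half xi).
by apply/andP; split; apply/eqP; ring.
Qed.

Lemma scheme_fourier_mode (dt c gamma beta msq : R) xi uhat n k :
  dt != 0 ->
  scheme dt c gamma beta msq (fourier_mode xi uhat) n k =
    (dt ^- 2)%:C * (cos (n%:~R * xi) +i* sin (n%:~R * xi)) *
    ((ghat dt c gamma beta msq xi)%:C * uhat (k + 1)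
     - (fhat dt c xi)%:C * uhat k
     + (hhat dt c gamma beta msq xi)%:C * uhat (k - 1)).
Proof.
move=> dt0; have dtC0 : dt%:C != 0 :> R[i] by rewrite fmorph_eq0.
rewrite /scheme /delta_sq /delta_t !delta_xx_fourier_mode.
rewrite /delta_tt /delta_bar /fourier_mode /ghat /fhat /hhat.
(* With the exponential and the sine opaque and the embedding of the reals pushed down to the
   parameters, a rational identity remains whose denominators are nonzero by [dtC0]. *)
set E := (_ +i* _); set s := sin (xi / 2).
rewrite !(rmorphD, rmorphB, rmorphN, rmorphM, rmorphXn, fmorphV, rmorph1, rmorph_nat) /=.
by field.
Qed.

(** The node n = 0, where the exponential is 1, already yields the recurrence; conversely, the
    recurrence annihilates a factor common to all nodes. *)
Lemma fourier_mode_solution (dt c gamma beta msq : R) xi uhat k :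
  dt != 0 ->
  (forall n, scheme dt c gamma beta msq (fourier_mode xi uhat) n k = 0) <->
  (ghat dt c gamma beta msq xi)%:C * uhat (k + 1) =
    (fhat dt c xi)%:C * uhat k - (hhat dt c gamma beta msq xi)%:C * uhat (k - 1).
Proof.
move=> dt0; split=> [/(_ 0)|e n]; rewrite scheme_fourier_mode //; last first.
  by rewrite e addrAC addrNK subrr mulr0.
rewrite mul0r cos0 sin0 mulr1.
move/eqP; rewrite mulf_eq0 fmorph_eq0 invr_eq0 expf_eq0 (negPf dt0) /=.
by rewrite addrAC subr_eq0 => /eqP <-; rewrite addrK.
Qed.

Lemma amplification_matrixP (dt c gamma beta msq : R) xi :
  dt != 0 -> ghat dt c gamma beta msq xi != 0 ->
  is_amplification_matrix (scheme dt c gamma beta msq) xi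
    (amplification_matrix dt c gamma beta msq xi).
Proof.
move=> dt0 g0 uhat k; rewrite fourier_mode_solution //.
set g := ghat _ _ _ _ _ _ in g0 *; set f := fhat _ _ _; set h := hhat _ _ _ _ _ _.
have gC0 : g%:C != 0 :> R[i] by rewrite fmorph_eq0.
have solve_g : uhat (k + 1) = (f / g)%:C * uhat k + (- (h / g))%:C * uhat (k - 1)
    <-> g%:C * uhat (k + 1) = f%:C * uhat k - h%:C * uhat (k - 1).
  rewrite !(rmorphN, rmorphM, fmorphV) /=.
  split=> [->|e]; first by field.
  by apply: (mulfI gC0); rewrite e; field.
(* Only the top entry carries information: the bottom one reads uhat (k + 1 - 1) = uhat k, true of
   every sequence. *)
rewrite -solve_g; split=> [e|/matrixP/(_ 0 0)]; last first.
  by rewrite !mxE !big_ord_recl big_ord0 !mxE /= addr0.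
apply/matrixP=> i j; rewrite !mxE !big_ord_recl big_ord0 !mxE /= addr0.
case: ifP => _; first by [].
by rewrite addrK rmorph1 rmorph0 mul1r mul0r addr0.
Qed.

Lemma norm_inf_amplification_matrix (dt c gamma beta msq : R) xi :
  0 < ghat dt c gamma beta msq xi ->
  `|fhat dt c xi| + `|hhat dt c gamma beta msq xi| <=
    ghat dt c gamma beta msq xi ->
  norm_inf (amplification_matrix dt c gamma beta msq xi) <= 1.
Proof.
move=> g0 fhg; apply: bigmax_le => // i _.
rewrite !big_ord_recl big_ord0 !mxE /= addr0.
case: ifP => _; last by rewrite normr1 normr0 addr0.
by rewrite normrN !normrM normfV (gtr0_norm g0) -mulrDl ler_pdivrMr // mul1r.
Qed.

End FourierModes.

Theorem proposition6 (R : realType) (dt c gamma beta msq : R)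
    (hdt : 0 < dt) (hc : 0 < c) (hgamma : 0 < gamma) (hbeta : 0 <= beta)
    (hmsq : 0 <= msq)
    (hlow : 2 / gamma < dt) (hup : dt < Num.sqrt 2 / c) :
  linearly_stable_inf (scheme dt c gamma beta msq)
    (amplification_matrix dt c gamma beta msq).
Proof.
move=> xi _.
have gdt : 2 < gamma * dt by rewrite mulrC -ltr_pdivrMr.
have cdt : c ^+ 2 * dt ^+ 2 < 2.
  rewrite -exprMn mulrC -[ltRHS]sqr_sqrtr // ltr_pXn2r ?nnegrE ?sqrtr_ge0 //.
    by rewrite -ltr_pdivlMr.
  by rewrite mulr_ge0 ?ltW.
have s0 : 0 <= sin (xi / 2) ^+ 2 by exact: sqr_ge0.
have s1 : sin (xi / 2) ^+ 2 <= 1.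
  by rewrite sin2cos2 gerBl sqr_ge0.
(* The remaining goals are linear in [gamma * dt] and the products bounded here, so [lra] can treat
   these as atoms. *)
have C0 : 0 <= c ^+ 2 * dt ^+ 2 * sin (xi / 2) ^+ 2.
  by rewrite -!exprMn sqr_ge0.
have C2 : c ^+ 2 * dt ^+ 2 * sin (xi / 2) ^+ 2 <= 2.
  by rewrite (le_trans _ (ltW cdt)) // ler_piMr // -exprMn sqr_ge0.
have B0 : 0 <= beta * dt * sin (xi / 2) ^+ 2 by rewrite mulr_ge0 // mulr_ge0 // ltW.
have M0 : 0 <= msq * dt ^+ 2 by rewrite mulr_ge0 ?sqr_ge0.
have g0 : 0 < ghat dt c gamma beta msq xi by rewrite /ghat; lra.
split; first by apply: amplification_matrixP; rewrite gt_eqF.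
apply: norm_inf_amplification_matrix => //.
rewrite /fhat /hhat /ghat.
(* With C, B, M the products of [C0], [B0], [M0]: f = 2 - 2 C, g - h = 4 B + gamma dt and g + h = 2
   + 2 C + M. The sign cases thus ask for |2 - 2 C| <= 4 B + gamma dt, where 0 <= C <= 2, and for 4
   C + M >= 0 and 4 + M >= 0. *)
by case: ger0P => _; case: ger0P => _; lra.
Qed.
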